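(* Suppose every agent is either of type P or does not satisfy (M). If there is an agent $i$ of type P and $\chi(0)\in\Delta_{A-1}^o$ such that $$\limsup_{N\to\infty}\frac{\sum_{k=\chi_i(0)N}^\infty 1/F_i(k)}{\sum_{k=\chi_j(0)N}^\infty 1/F_j(k)}<1\quad\text{for all }j\ne i,$$ then $\lim_{N\to\infty}\mathbb{P}(sMon_i(\chi(0),N))=1$.
   Context: Fix $A\ge 2$, $[A]=\{1,\dots,A\}$, and feedback functions $F_i:\mathbb{N}\to(0,\infty)$. The generalized Pólya urn is the Markov chain $X(n)\in\mathbb{N}^A$, $n\in\mathbb{N}_0$, with $X_i(0)\ge1$ and $\mathbb{P}(X(n+1)=X(n)+e^{(i)}\mid X(n))=F_i(X_i(n))/\sum_{j}F_j(X_j(n))$. $N=\sum_iX_i(0)$; $\Delta_{A-1}^o$ is the interior of the simplex $\{x\in[0,1]^A:\sum x_i=1\}$. For fixed $\chi(0)\in\Delta_{A-1}^o$ the process starts from $X_i(0)=\chi_i(0)N$ (rounded; sums with non-integer lower limit start at the rounded value). Strong monopoly: $sMon_i(\chi(0),N)=\{\lim_{n\to\infty}\sum_{j\ne i}X_j(n)<\infty\}$. Condition (M) for agent $i$: $\sum_{k\ge1}1/F_i(k)<\infty$ (if it fails, the denominator sum above is $+\infty$). Agent $i$ is of type P if it satisfies (M) and $\lim_{k\to\infty}F_i(k)\sum_{l=k}^\infty1/F_i(l)=\infty$. *)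

(* Defs.v *)
From HB Require Import structures.
From mathcomp Require Import all_boot all_order all_algebra.
From mathcomp Require Import all_classical all_reals all_analysis.
Set Implicit Arguments. Unset Strict Implicit. Unset Printing Implicit Defensive.
Import Order.TTheory GRing.Theory Num.Theory.
Import numFieldNormedType.Exports.
Local Open Scope classical_set_scope.
Local Open Scope ring_scope.

(* A configuration of the urn: number of balls of each agent. *)
Definition config (A : nat) := 'I_A -> nat.

Definition incr (A : nat) (x : config A) (i : 'I_A) : config A :=
  fun j => if j == i then (x j).+1 else x j.

Definition Zsum (R : realType) (A : nat) (F : 'I_A -> nat -> R) (x : config A) : R :=
  \sum_(j < A) F j (x j).

Definition trans (R : realType) (A : nat) (F : 'I_A -> nat -> R)
  (x y : config A) : R :=
  \sum_(i < A) (if [forall j, y j == incr x i j]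
                then F i (x i) / Zsum F x else 0).

Definition tail (R : realType) (A : nat) (F : 'I_A -> nat -> R) (i : 'I_A) (k : nat)
  : \bar R := (\sum_(k <= l <oo) ((F i l)^-1)%:E)%E.

Definition condM (R : realType) (A : nat) (F : 'I_A -> nat -> R) (i : 'I_A) : Prop :=
  (\sum_(1 <= k <oo) ((F i k)^-1)%:E < +oo)%E.

Definition typeP (R : realType) (A : nat) (F : 'I_A -> nat -> R) (i : 'I_A) : Prop :=
  condM F i /\
  ((fun k : nat => ((F i k)%:E * tail F i k)%E) @ \oo --> +oo%E).

Definition start (R : realType) (A : nat) (chi : 'I_A -> R) (N : nat) : config A :=
  fun i => `|Num.ceil (chi i * N%:R)|%N.

Definition in_open_simplex (R : realType) (A : nat) (chi : 'I_A -> R) : Prop :=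
  (forall i, 0 < chi i) /\ \sum_(i < A) chi i = 1.

(* [X] is (a version of) the generalized Polya urn started from x0 on the
   probability space (T, P): X_n is measurable (discrete), X_0 = x0 a.s.,
   and the finite-dimensional laws follow the Markov transition [trans F]. *)
Definition is_polya_urn (R : realType) (A : nat) (F : 'I_A -> nat -> R)
  (d : measure_display) (T : measurableType d) (P : probability T R)
  (x0 : config A) (X : nat -> T -> config A) : Prop :=
  (forall (n : nat) (x : config A), measurable [set w | X n w = x]) /\
  P [set w | X 0%N w = x0] = 1%E /\
  (forall (n : nat) (xs : nat -> config A),
     P [set w | forall k, (k <= n.+1)%N -> X k w = xs k] =
     (P [set w | forall k, (k <= n)%N -> X k w = xs k]
      * (trans F (xs n) (xs n.+1))%:E)%E).

(* strong monopoly of agent i: lim_n sum_{j<>i} X_j(n) < oo *)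
Definition sMon (R : realType) (A : nat) (i : 'I_A) (T : Type)
  (X : nat -> T -> config A) : set T :=
  [set w | cvg ((fun n => ((\sum_(j < A | j != i) X n w j)%N%:R : R)) @ \oo)].
Arguments sMon R {A} i {T} X.

(* Main.v *)
(** For a rival [j] of [i] and [lam > 0], the function
    [prod_(l < x_i) (1 - lam / F_i l) * prod_(l < x_j) (1 + lam / F_j l)] of the
    state [x] is a martingale of the urn, with value 1 at the start.
    If [j] ever reaches a level [K], its value is at least
    [exp(- lam * tail_i) * prod_(l < K) (1 + lam / F_j l)] up to second-order
    terms. Choose [lam = c / tail_j]: type P makes [lam / F] uniformly small,
    so for large [K] this is about [exp(c * (1 - tail_i / tail_j))], which is
    arbitrarily large since [tail_i / tail_j] stays below 1; when [j] violates
    (M), [lam = 1 / tail_i] works because the second product diverges. By the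
    maximal inequality, with high probability no rival [j] ever reaches its
    level [K_j], and a bounded nondecreasing total of the rivals converges.
    This replaces the exponential embedding of the urn. *)

Require Import Defs.
From HB Require Import structures.
From mathcomp Require Import all_boot all_order all_algebra.
From mathcomp Require Import all_classical all_reals all_analysis.
From mathcomp Require Import ring lra.
Import Order.TTheory GRing.Theory Num.Theory.
Import numFieldNormedType.Exports.
Local Open Scope classical_set_scope.
Local Open Scope ring_scope.
Set Implicit Arguments. Unset Strict Implicit. Unset Printing Implicit Defensive.

(** * Maximal inequality for the urn *)

(** The laws make each move of this form only almost surely; paths that break it are carried along
    as a null event. *)
Definition urn_step (A : nat) (x y : config A) : Prop := exists l, y = incr x l.

Lemma incr_inj (A : nat) (x : config A) : injective (incr x).
Proof.
move=> k l /(congr1 (fun f => f k)); rewrite /incr eqxx.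
by case: eqP => // _ /eqP; rewrite eqn_leq ltnn.
Qed.

Lemma leq_incr (A : nat) (x : config A) (l k : 'I_A) : (x k <= incr x l k)%N.
Proof. by rewrite /incr; case: eqP. Qed.

Lemma countable_config (A : nat) : countable [set: config A].
Proof.
apply/countable_injP; exists (fun x => pickle [ffun k => x k]) => x y _ _.
move=> /(pcan_inj pickleK) /ffunP xy; apply/funext => k.
by have := xy k; rewrite !ffunE.
Qed.

Lemma trans_incr (R : realType) (A : nat) (F : 'I_A -> nat -> R)
  (x : config A) (l : 'I_A) : trans F x (incr x l) = F l (x l) / Zsum F x.
Proof.
rewrite /trans (bigD1 l)//= big1 ?addr0 => [|k kl].
  by case: forallP => // -[] j.
case: forallP => // /(_ _)/eqP-e; have /incr_inj lk : incr x l = incr x k.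
  by apply/funext => j.
by rewrite lk eqxx in kl.
Qed.

Lemma Zsum_gt0 (R : realType) (A : nat) (F : 'I_A -> nat -> R) (x : config A) :
  (0 < A)%N -> (forall l k, 0 < F l k) -> 0 < Zsum F x.
Proof.
move=> A0 F0; rewrite /Zsum (bigD1 (Ordinal A0))//= ltr_wpDr//.
by apply: sumr_ge0 => k _; exact/ltW.
Qed.

Lemma mem_bigsetU (n : nat) (U : Type) (E : 'I_n -> set U) (w : U) :
  (\big[setU/set0]_(l < n) E l) w <-> exists l, E l w.
Proof.
rewrite -(bigcup_pred xpredT); split => [[l _ El]|[l El]]; by exists l.
Qed.

Lemma measure_bigsetU_le (R : realType) (d : measure_display)
    (T : measurableType d) (P : probability T R) (n : nat)
    (C : {pred 'I_n}) (E : 'I_n -> set T) :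
  (forall l, measurable (E l)) ->
  (P (\big[setU/set0]_(l < n | C l) E l) <= \sum_(l < n | C l) P (E l))%E.
Proof.
move=> mE; suff [] : measurable (\big[setU/set0]_(l < n | C l) E l) /\
  (P (\big[setU/set0]_(l < n | C l) E l) <= \sum_(l < n | C l) P (E l))%E by [].
apply: (big_rec2 (fun S s => measurable S /\ (P S <= s)%E)) => 
  [|l y1 y2 _ [my PS]]; first by rewrite measure0.
split; first exact: measurableU.
by apply: (le_trans (measureU2 _ _ _)) => //; exact: leeD.
Qed.

(** * Measurability and cylinder probabilities *)

Section urn.
Context (R : realType) (A : nat) (F : 'I_A -> nat -> R).
Context (d : measure_display) (T : measurableType d) (P : probability T R).
Context (x0 : config A) (X : nat -> T -> config A).
Hypothesis A0 : (0 < A)%N.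
Hypothesis F0 : forall l k, 0 < F l k.
Hypothesis urnX : is_polya_urn F P x0 X.

(** Only the atoms [X n w = x] are measurable by assumption; countably many of them make up any
    event about [X n]. *)
Lemma measurable_urn (n : nat) (Q : set (config A)) :
  measurable [set w | Q (X n w)].
Proof.
rewrite (_ : mkset _ = \bigcup_x [set w | X n w = x /\ Q x]); last first.
  apply/seteqP; split => w /=; first by move=> Qw; exists (X n w).
  by move=> [x _ /= [-> ]].
apply: countable_bigcupT_measurable => [|x]; first exact: countable_config.
have [Qx|Qx] := pselect (Q x).
  rewrite (_ : mkset _ = [set w | X n w = x]); first exact: urnX.1.
  by apply/seteqP; split => w /= => [[]|].
rewrite (_ : mkset _ = set0); first exact: measurable0.
by apply/seteqP; split => w /= => [[]|].
Qed.

Lemma measurable_urn2 (n m : nat) (Q : config A -> set (config A)) :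
  measurable [set w | Q (X n w) (X m w)].
Proof.
rewrite (_ : mkset _ =
  \bigcup_x ([set w | X n w = x] `&` [set w | Q x (X m w)])); last first.
  apply/seteqP; split => w /=; first by move=> Qw; exists (X n w).
  by move=> [x _ /= [-> ]].
apply: countable_bigcupT_measurable => [|x]; first exact: countable_config.
apply: measurableI; last exact: (measurable_urn m (Q x)).
exact: (measurable_urn n (fun y => y = x)).
Qed.

Definition cylinder (n : nat) (xs : nat -> config A) : set T :=
  [set w | forall k, (k <= n)%N -> X k w = xs k].

Lemma measurable_cylinder n xs : measurable (cylinder n xs).
Proof.
rewrite (_ : cylinder n xs =
  \bigcap_k [set w | (k <= n)%N -> X k w = xs k]); last first.
  by apply/seteqP; split => w /= h k; [move=> _; exact: h|exact: h].
apply: bigcapT_measurable => k.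
exact: (measurable_urn k (fun x => (k <= n)%N -> x = xs k)).
Qed.

Definition extend (n : nat) (xs : nat -> config A) (y : config A) k :=
  if (k <= n)%N then xs k else y.

Lemma extend_le n xs y k : (k <= n)%N -> extend n xs y k = xs k.
Proof. by rewrite /extend => ->. Qed.

Lemma extend_succ n xs y : extend n xs y n.+1 = y.
Proof. by rewrite /extend ltnn. Qed.

Lemma cylinderS n xs y :
  cylinder n.+1 (extend n xs y) = cylinder n xs `&` [set w | X n.+1 w = y].
Proof.
apply/seteqP; split => w /=; rewrite /cylinder/extend /=.
  move=> h; split=> [k kn|].
    by have := h k (leqW kn); rewrite kn.
  by have := h n.+1 (leqnn _); rewrite ltnn.
move=> [h e] k; rewrite leq_eqVlt => /orP[/eqP->|]; first by rewrite ltnn.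
by rewrite ltnS => kn; rewrite kn; exact: h.
Qed.

Lemma prob_cylinderS n xs l :
  P (cylinder n.+1 (extend n xs (incr (xs n) l))) =
  (P (cylinder n xs) * (F l (xs n l) / Zsum F (xs n))%:E)%E.
Proof.
have [_ [_ /(_ n (extend n xs (incr (xs n) l)))]] := urnX.
rewrite extend_le// extend_succ trans_incr => ->; congr (P _ * _)%E.
by apply/seteqP; split => w /= h k kn; have := h k kn; rewrite /extend kn.
Qed.

(** The cylinders prolonged by the [A] possible increments are disjoint, and their probabilities add
    up to that of the whole, as the ratios of [F l] to [Zsum F] sum to 1. *)
Lemma prob_cylinder_nostep n xs :
  P (cylinder n xs `&` [set w | ~ urn_step (X n w) (X n.+1 w)]) = 0%E.
Proof.
set C := cylinder n xs; pose U l := cylinder n.+1 (extend n xs (incr (xs n) l)).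
have mU l : measurable (U l) by exact: measurable_cylinder.
have mC : measurable C by exact: measurable_cylinder.
have PU : P (\big[setU/set0]_(l < A) U l) = P C.
  rewrite measure_bigsetU_ord//; last first.
    apply/trivIsetP => k l _ _ /eqP kl; apply/seteqP; split => // w [].
    by rewrite /U !cylinderS => -[_ /= ->] [_ /= /incr_inj].
  rewrite (eq_bigr _ (fun l _ => prob_cylinderS n xs l)) -/C.
  rewrite -ge0_sume_distrr; last first.
    by move=> l _; rewrite lee_fin divr_ge0 ?ltW ?Zsum_gt0.
  by rewrite sumEFin -mulr_suml mulfV ?mule1// gt_eqF ?Zsum_gt0.
rewrite (_ : _ `&` _ = C `\` \big[setU/set0]_(l < A) U l); last first.
  apply/seteqP; split => w [Cw nw]; split => //.
    move=> /mem_bigsetU [l]; rewrite /U cylinderS => -[_ /= e].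
    by apply: nw; exists l; rewrite e (Cw n).
  move=> [l e]; apply: nw; apply/mem_bigsetU; exists l.
  by rewrite /U cylinderS; split => //=; rewrite e (Cw n).
have mUU : measurable (\big[setU/set0]_(l < A) U l).
  exact: bigsetU_measurable.
rewrite measureD//; last by rewrite ltey_eq fin_num_measure.
rewrite setIidr.
  rewrite [X in (_ - X)%E]PU.
  by apply: subee; rewrite fin_num_measure.
by move=> w /mem_bigsetU[l]; rewrite /U cylinderS => -[].
Qed.

(** * Maximal inequality for a nonnegative supermartingale *)

Context (h : config A -> R) (bad : set (config A)).
Hypothesis h0 : forall x, (forall l, x0 l <= x l)%N -> 0 <= h x.
(** The supermartingale inequality, multiplied by [Zsum F x]. It is asked only above [x0], where a
    path stays as long as its moves are increments. *)
Hypothesis hsuper : forall x, (forall l, x0 l <= x l)%N ->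
  \sum_l F l (x l) * h (incr x l) <= Zsum F x * h x.
Hypothesis hbad : forall x, (forall l, x0 l <= x l)%N -> bad x -> 1 <= h x.

(** Moves that are not increments count as hits: they have probability 0, and a path without hits is
    a genuine urn path. *)
Let hit k : set T := [set w | bad (X k w) \/ ~ urn_step (X k w) (X k.+1 w)].

Let measurable_hit k : measurable (hit k).
Proof.
exact: (@measurable_urn2 k k.+1 (fun x y => bad x \/ ~ urn_step x y)).
Qed.

Let hits n m := [set w | exists2 k, (n <= k < n + m)%N & hit k w].

Let measurable_hits n m : measurable (hits n m).
Proof.
rewrite (_ : hits n m = \bigcup_(k in [set k | n <= k < n + m]%N) hit k).
  by apply: bigcup_measurable => k _; exact: measurable_hit.
by apply/seteqP; split => w [k] ? ?; exists k.
Qed.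

Let hits0 n : hits n 0 = set0.
Proof.
apply/seteqP; split => // w [k]; rewrite addn0 => /andP[nk].
by rewrite ltnNge nk.
Qed.

(* Conditioning on a cylinder and moving one step at a time stands in for
   optional stopping. *)
Let prob_hits m n xs : (forall l, x0 l <= xs n l)%N ->
  (P (cylinder n xs `&` hits n m) <= P (cylinder n xs) * (h (xs n))%:E)%E.
Proof.
elim: m n xs => [|m IH] n xs x0x.
  by rewrite hits0 setI0 measure0 mule_ge0// lee_fin h0.
have mC : measurable (cylinder n xs) by exact: measurable_cylinder.
have [bx|nbx] := pselect (bad (xs n)).
  apply: (@le_trans _ _ (P (cylinder n xs))).
    by rewrite le_measure ?inE//; exact: measurableI.
  by rewrite lee_pemulr// lee_fin hbad.
pose U l := cylinder n.+1 (extend n xs (incr (xs n) l)).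
have mU l : measurable (U l) by exact: measurable_cylinder.
pose N := cylinder n xs `&` [set w | ~ urn_step (X n w) (X n.+1 w)].
have mN : measurable N.
  apply: measurableI => //.
  exact: (@measurable_urn2 n n.+1 (fun x y => ~ urn_step x y)).
pose V := \big[setU/set0]_(l < A) (U l `&` hits n.+1 m).
have mUh l : measurable (U l `&` hits n.+1 m) by exact: measurableI.
have mV : measurable V by exact: bigsetU_measurable.
(* From a good state, a hit in the window is a forbidden move at time [n] or a hit in the shorter
   window after one increment. *)
have sub : cylinder n xs `&` hits n m.+1 `<=` N `|` V.
  move=> w [Cw [k nkm hk]].
  have [[l el]|nst] := pselect (urn_step (X n w) (X n.+1 w)); last by left.
  right; apply/mem_bigsetU; exists l; split.
    by rewrite /U cylinderS; split => //=; rewrite el (Cw n).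
  case/andP: nkm => nk km; exists k => //.
  rewrite addSnnS km andbT ltn_neqAle nk andbT; apply/eqP => nE.
  move: hk; rewrite -nE => -[]; first by rewrite (Cw n).
  by apply; exists l.
apply: (@le_trans _ _ (P (N `|` V))).
  by rewrite le_measure ?inE//; [exact: measurableI|exact: measurableU].
apply: (le_trans (measureU2 _ _ _)) => //.
rewrite [X in (X + _)%E]prob_cylinder_nostep add0e.
apply: (le_trans (measure_bigsetU_le P _ _)) => //.
have x0S l : (forall k, x0 k <= incr (xs n) l k)%N.
  by move=> k; exact: leq_trans (x0x k) (leq_incr _ _ _).
apply: (@le_trans _ _ (\sum_(l < A) (P (cylinder n xs) *
    (F l (xs n l) / Zsum F (xs n) * h (incr (xs n) l))%:E))%E).
  apply: lee_sum => l _; have := IH n.+1 (extend n xs (incr (xs n) l)).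
  rewrite extend_succ prob_cylinderS => /(_ (x0S l)).
  by rewrite -muleA -EFinM.
rewrite -ge0_sume_distrr; last first.
  by move=> l _; rewrite lee_fin !mulr_ge0 ?invr_ge0 ?h0// ltW// Zsum_gt0.
rewrite lee_pmul// ?sumEFin ?lee_fin.
  by apply: sumr_ge0 => l _; rewrite !mulr_ge0 ?invr_ge0 ?h0// ltW// Zsum_gt0.
rewrite (eq_bigr (fun l => F l (xs n l) * h (incr (xs n) l) / Zsum F (xs n))).
  by rewrite -mulr_suml ler_pdivrMr ?Zsum_gt0// mulrC hsuper.
by move=> l _; rewrite mulrAC.
Qed.

Lemma measurable_hit_ever : measurable
  [set w | exists k, bad (X k w) \/ ~ urn_step (X k w) (X k.+1 w)].
Proof.
rewrite (_ : mkset _ = \bigcup_k hit k).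
  by apply: bigcupT_measurable => k; exact: measurable_hit.
by apply/seteqP; split => w [k]; exists k.
Qed.

(** The finite-horizon bounds pass to the limit by continuity of [P] along increasing events;
    starting away from [x0] has probability 0. *)
Lemma prob_hit_ever : (P
  [set w | exists k, bad (X k w) \/ ~ urn_step (X k w) (X k.+1 w)] <=
  (h x0)%:E)%E.
Proof.
set H := mkset _; have mH : measurable H by exact: measurable_hit_ever.
pose S : set T := [set w | X 0%N w = x0]; have [mX [PS _]] := urnX.
have mS : measurable S by exact: mX.
pose V := \bigcup_m (S `&` hits 0 m).
have mV : measurable V.
  by apply: bigcupT_measurable => m; exact: measurableI.
have HV : H `<=` V `|` ~` S.
  move=> w [k hk]; have [Sw|nSw] := pselect (S w); last by right.
  by left; exists k.+1 => //; split => //; exists k => //=; rewrite add0n leqnn.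
apply: (@le_trans _ _ (P (V `|` ~` S))).
  by rewrite le_measure ?inE//; apply: measurableU => //; exact: measurableC.
apply: (le_trans (measureU2 _ _ _)) => //; first exact: measurableC.
have PSC : P (~` S) = 0%E by rewrite probability_setC// PS subee.
rewrite [X in (_ + X)%E]PSC adde0.
have ndV : {homo (fun m => S `&` hits 0 m) : a b / (a <= b)%N >-> (a <= b)%O}.
  move=> a b ab; apply/subsetPset => w [Sw [k ka hk]]; split => //.
  exists k => //; move: ka; rewrite !add0n/= => ka; exact: leq_trans ka ab.
have cV : P (S `&` hits 0 m) @[m --> \oo] --> P V.
  by apply: nondecreasing_cvg_mu => // m; exact: measurableI.
suff PVh : (P V <= (h x0)%:E)%E by exact: PVh.
rewrite -(cvg_lim _ cV)//; apply: lime_le; first by apply/cvg_ex; exists (P V).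
apply: nearW => m; have SE : S = cylinder 0 (fun=> x0).
  apply/seteqP; split => w /=; last by apply.
  by move=> Sw k; rewrite leqn0 => /eqP->.
by rewrite {1}SE (le_trans (prob_hits _ _))// -SE PS mul1e.
Qed.

End urn.

(** * Tails and products *)

Section tail.
Context (R : realType) (A : nat) (F : 'I_A -> nat -> R).
Hypothesis F0 : forall l k, 0 < F l k.

Lemma partial_le_tail j k m :
  ((\sum_(k <= l < m) (F j l)^-1)%:E <= tail F j k)%E.
Proof.
rewrite -sumEFin; apply: nneseries_lim_ge => l _ _.
by rewrite lee_fin invr_ge0 ltW.
Qed.

(** Were all partial sums at most [c], so would be their limit. An infinite tail is included, for
    rivals violating (M). *)
Lemma lt_tail j k (c : R) : (c%:E < tail F j k)%E ->
  exists K, c < \sum_(k <= l < K) (F j l)^-1.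
Proof.
move=> ct; apply/not_existsP => h; move: ct; apply/negP; rewrite -leNgt.
apply: lime_le.
  by apply: is_cvg_nneseries => l _ _; rewrite lee_fin invr_ge0 ltW.
apply: nearW => m; rewrite sumEFin lee_fin leNgt; apply/negP; exact: h.
Qed.

Lemma tail_gt0 j k : (0 < tail F j k)%E.
Proof.
apply: lt_le_trans (partial_le_tail j k k.+1).
by rewrite big_nat1 lte_fin invr_gt0.
Qed.

Lemma tailS j k : tail F j k = ((F j k)^-1%:E + tail F j k.+1)%E.
Proof.
rewrite /tail (nneseries_split k 1) ?addn1 ?big_nat1// => l _.
by rewrite lee_fin invr_ge0 ltW.
Qed.

(** Removing one finite term does not change whether the series is finite, so the starting index 1
    of [condM] can be moved, also down to 0. *)
Lemma condM_tail j k : condM F j <-> (tail F j k < +oo)%E.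
Proof.
have tS l : (tail F j l < +oo)%E = (tail F j l.+1 < +oo)%E.
  rewrite tailS; have := tail_gt0 j l.+1.
  by case: (tail F j l.+1) => // r _; rewrite !ltry.
rewrite /condM -/(tail F j 1) -tS.
suff -> : (tail F j k < +oo)%E = (tail F j 0 < +oo)%E by [].
by elim: k => // k; rewrite tS.
Qed.

Lemma condM_tailE j k : condM F j ->
  exists2 t : R, 0 < t & tail F j k = t%:E.
Proof.
move=> /(condM_tail j k) too; have := tail_gt0 j k.
by case: (tail F j k) too => // t _; rewrite lte_fin; exists t.
Qed.

Lemma tail_anti j k l : (k <= l)%N -> (tail F j l <= tail F j k)%E.
Proof.
move=> /subnK<-; elim: (l - k)%N => // n; apply: le_trans.
by rewrite addSn [leRHS]tailS leeDr// lee_fin invr_ge0 ltW.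
Qed.

(** Type P gives [F j l * tail F j l >= c / dl] for large [l], and [tail F j l <= t <= s]. The
    separate scale [s] lets agent [i] be measured by the larger tail of a rival. *)
Lemma typeP_ratio j (c dl : R) : 0 < c -> 0 < dl -> typeP F j ->
  exists k0, forall (a l : nat) (t s : R), (k0 <= a)%N -> (a <= l)%N ->
    tail F j a = t%:E -> t <= s -> c / s / F j l <= dl.
Proof.
move=> c0 dl0 [Mj /cvgeyPge/(_ (c / dl))[k0 _ Hk0]]; exists k0 => a l t s ka al ta ts.
have [u u0 tl] := condM_tailE l Mj.
have := Hk0 l (leq_trans ka al); rewrite /= tl -EFinM lee_fin => Fu.
have us : u <= s.
  by apply: le_trans ts; rewrite -lee_fin -ta -tl; exact: tail_anti.
have s0 : 0 < s by exact: lt_le_trans us.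
rewrite !ler_pdivrMr//; rewrite ler_pdivrMr// in Fu.
apply: (le_trans Fu); rewrite mulrC -mulrA ler_pM2l// mulrC.
by rewrite mulrC ler_pM2l.
Qed.

End tail.

(** * Exponential and linear bounds for products *)

Section products.
Context (R : realType).
Implicit Types (x dl lam t : R) (f : nat -> R).

(** [1 / (1 - x) = 1 + x / (1 - x) <= 1 + x / (1 - dl) <= expR (x / (1 - dl))]. *)
Lemma expR_le1B x dl : 0 <= x -> x <= dl -> dl < 1 ->
  expR (- (x / (1 - dl))) <= 1 - x.
Proof.
move=> x0 xd d1; have x1 : 0 < 1 - x by lra.
rewrite expRN -[leRHS]invrK lef_pV2 ?posrE ?expR_gt0 ?invr_gt0//.
apply: le_trans (expR_ge1Dx _).
apply: (@le_trans _ _ (1 + x / (1 - x))).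
  by rewrite le_eqVlt; apply/orP; left; apply/eqP; field; lra.
by rewrite lerD2l ler_wpM2l// lef_pV2 ?posrE; lra.
Qed.

(** [(1 - dl) * (1 + x) <= 1] gives [(1 - dl) * x <= x / (1 + x)], and [1 / (1 + x) = 1 - x / (1 +
    x) <= expR (- (x / (1 + x)))]. *)
Lemma expR_le1D x dl : 0 <= x -> x <= dl -> expR ((1 - dl) * x) <= 1 + x.
Proof.
move=> x0 xd; have x1 : 0 < 1 + x by lra.
apply: (@le_trans _ _ (expR (x / (1 + x)))).
  by rewrite ler_expR ler_pdivlMr//; nra.
rewrite -[leRHS]invrK -[leLHS]invrK lef_pV2 ?posrE ?invr_gt0 ?expR_gt0//.
rewrite -expRN; apply: le_trans (expR_ge1Dx _).
by rewrite le_eqVlt; apply/orP; left; apply/eqP; field; lra.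
Qed.

Lemma expR_le_prod1B f lam dl (a m : nat) : dl < 1 ->
  (forall l, (a <= l)%N -> 0 <= lam / f l <= dl) ->
  expR (- (lam / (1 - dl) * \sum_(a <= l < m) (f l)^-1)) <=
  \prod_(a <= l < m) (1 - lam / f l).
Proof.
move=> d1 h; rewrite [leRHS]big_nat [X in _ * X]big_nat.
apply: (big_rec2 (fun s p => expR (- (lam / (1 - dl) * s)) <= p)).
  by rewrite mulr0 oppr0 expR0.
move=> l s p /andP[al _] IH; have /andP[x0 xd] := h l al.
rewrite mulrDr opprD expRD ler_pM ?expR_ge0//.
by rewrite mulrAC; exact: expR_le1B.
Qed.

Lemma expR_le_prod1D f lam dl (a m : nat) :
  (forall l, (a <= l)%N -> 0 <= lam / f l <= dl) ->
  expR ((1 - dl) * lam * \sum_(a <= l < m) (f l)^-1) <=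
  \prod_(a <= l < m) (1 + lam / f l).
Proof.
move=> h; rewrite [leRHS]big_nat [X in _ * X]big_nat.
apply: (big_rec2 (fun s p => expR ((1 - dl) * lam * s) <= p)).
  by rewrite mulr0 expR0.
move=> l s p /andP[al _] IH; have /andP[x0 xd] := h l al.
rewrite mulrDr expRD ler_pM ?expR_ge0//.
by rewrite -mulrA; exact: expR_le1D.
Qed.

(** Nothing bounds [lam / F j l] for a rival violating (M), so a linear bound, divergent with the
    sum, takes the place of the exponential one. *)
Lemma sum_le_prod1D f lam (a m : nat) : (forall l, 0 <= lam / f l) ->
  1 + lam * \sum_(a <= l < m) (f l)^-1 <= \prod_(a <= l < m) (1 + lam / f l).
Proof.
move=> h.
apply: (@proj2 (0 <= lam * \sum_(a <= l < m) (f l)^-1)).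
apply: (big_rec2 (fun s p => 0 <= lam * s /\ 1 + lam * s <= p)).
  by rewrite mulr0 addr0.
by move=> l s p _ [s0 IH]; have := h l; rewrite mulrDr; split; nra.
Qed.

End products.

(** * Strong monopoly *)

(* With [lam] below all [F i l] and without the cap [K], the process
   [\prod_(l < X_i) (1 - lam / F i l) * \prod_(l < X_j) (1 + lam / F j l)] is
   an exact martingale: the two drifts are [- lam] and [+ lam] times its value.
   Freezing the second factor at [K] only lowers the drift. *)
Lemma prob_reach_le (R : realType) (A : nat) (F : 'I_A -> nat -> R)
  (d : measure_display) (T : measurableType d) (P : probability T R)
  (x0 : config A) (X : nat -> T -> config A) (i j : 'I_A) (lam q : R) (K : nat) :
  (forall l k, 0 < F l k) -> is_polya_urn F P x0 X -> j != i -> 0 <= lam ->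
  (forall l, (x0 i <= l)%N -> lam / F i l <= 1) -> 0 < q ->
  (forall m, q <= \prod_(x0 i <= l < m) (1 - lam / F i l)) ->
  (P [set w | exists k, (K <= X k w j)%N \/ ~ urn_step (X k w) (X k.+1 w)] <=
   (q * \prod_(x0 j <= l < K) (1 + lam / F j l))^-1%:E)%E.
Proof.
move=> F0 urnX ji lam0 lamF q0 qle.
have A0 : (0 < A)%N by apply: leq_ltn_trans (ltn_ord i).
pose Q m := \prod_(x0 i <= l < m) (1 - lam / F i l).
pose W m := \prod_(x0 j <= l < minn m K) (1 + lam / F j l).
(* Once [j] has reached [K], the product of [Q] and [W] is at least [th]; dividing by [th] makes [h]
   at least 1 there and [th^-1] at the start. *)
pose th := q * \prod_(x0 j <= l < K) (1 + lam / F j l).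
have W1 l : 1 <= 1 + lam / F j l.
  by rewrite lerDl divr_ge0// ltW.
have W0 m : 0 <= W m by apply: prodr_ge0 => l _; exact: le_trans (W1 l).
have th0 : 0 < th.
  rewrite mulr_gt0//; apply: prodr_gt0 => l _; exact: lt_le_trans (W1 l).
have Q0 m : 0 <= Q m by apply: ltW; exact: lt_le_trans (qle m).
have QS m : (x0 i <= m)%N -> Q m.+1 = Q m * (1 - lam / F i m).
  by move=> xm; rewrite /Q big_nat_recr.
have WS m : (x0 j <= m)%N -> W m.+1 <= W m * (1 + lam / F j m).
  move=> xm; rewrite /W; have [mK|Km] := ltnP m K.
    by rewrite (minn_idPl mK) big_nat_recr.
  rewrite (minn_idPr (leqW Km)); apply: ler_peMr => //.
    by apply: prodr_ge0 => l _; exact: le_trans (W1 l).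
have incrE (x : config A) (l k : 'I_A) : k != l -> incr x l k = x k.
  by rewrite /incr => /negbTE->.
have incrx (x : config A) (l : 'I_A) : incr x l l = (x l).+1.
  by rewrite /incr eqxx.
have sum1 (k : 'I_A) : \sum_l (l == k)%:R = 1 :> R.
  by rewrite (bigD1 k)//= eqxx big1 ?addr0// => l /negbTE->.
pose h x := Q (x i) * W (x j) / th.
have h0 x : 0 <= h x by rewrite !mulr_ge0// invr_ge0 ltW.
have -> : th^-1 = h x0.
  by rewrite /h /Q /W !big_geq// ?geq_minl// !mul1r.
apply: (@prob_hit_ever R A F d T P x0 X A0 F0 urnX h (fun x => (K <= x j)%N)) => //.
- move=> x x0x.
  (* The added terms cancel in the sum and balance the drift agent by agent: the move of [j] gains
     at most [lam * h x], that of [i] loses exactly [lam * h x]. *)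
  have -> : Zsum F x * h x = \sum_l (F l (x l) * h x +
      ((l == j)%:R - (l == i)%:R) * (lam * h x)).
    rewrite big_split/= -!mulr_suml sumrB.
    by rewrite !sum1 subrr mul0r addr0.
  apply: ler_sum => l _; have Fl := F0 l (x l).
  have [lj|lj] := eqVneq l j.
    rewrite lj (negbTE ji) subr0 mul1r -mulrDl /h incrE 1?eq_sym// incrx.
    have {lj}Fl := F0 j (x j).
    have := WS _ (x0x j); set w := W _; set w' := W _ => ww.
    rewrite !mulrA ler_pM2r ?invr_gt0// -!mulrA.
    apply: (@le_trans _ _ (F j (x j) * (Q (x i) * (w' * (1 + lam / F j (x j)))))).
      by rewrite ler_wpM2l ?ler_wpM2l// ltW.
    by rewrite le_eqVlt; apply/orP; left; apply/eqP; field; exact: lt0r_neq0.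
  have [li|li] := eqVneq l i.
    rewrite li sub0r mulN1r /h incrx incrE// QS//.
    have {lj li}Fl := F0 i (x i).
    by rewrite le_eqVlt; apply/orP; left; apply/eqP; field; rewrite !lt0r_neq0.
  by rewrite subrr mul0r addr0 /h !incrE// eq_sym.
- move=> x x0x Kx; rewrite /h ler_pdivlMr// mul1r /th /W (minn_idPr Kx).
  apply: ler_wpM2r; last exact: qle.
  by apply: prodr_ge0 => l _; exact: le_trans (W1 l).
Qed.

Lemma start_near (R : realType) (A : nat) (chi : 'I_A -> R) (j : 'I_A) (k0 : nat) :
  0 < chi j -> \forall N \near \oo, (k0 <= start chi N j)%N.
Proof.
move=> c0; near=> N.
rewrite /start -lez_nat abszE; apply: le_trans (ler_norm _).
rewrite -(ler_int R); apply: (@le_trans _ _ (chi j * N%:R)); last by rewrite -ceil_le_int.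
rewrite -ler_pdivrMl//; near: N; exact: nbhs_infty_ger.
Unshelve. all: by end_near. Qed.

(** The limsup is an infimum of suprema over neighbourhoods of infinity, so one of these suprema is
    already below 1. *)
Lemma limn_esup_lt1 (R : realType) (u : nat -> \bar R) : (limn_esup u < 1)%E ->
  exists2 r : R, r < 1 & \forall N \near \oo, (u N <= r%:E)%E.
Proof.
move=> /ereal_inf_lt[_ [V nV <-]] s1.
suff [r r1 sr] : exists2 r : R, r < 1 & (ereal_sup (u @` V) <= r%:E)%E.
  exists r => //; apply: filterS nV => N VN.
  by apply: le_trans sr; apply: ereal_sup_ubound; exists N.
case: (ereal_sup _) s1 => [r||]//; first by rewrite lte_fin; exists r.
by exists 0; rewrite ?leNye.
Qed.

(** * Probability that a rival reaches a high level *)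

Section reach.
Context (R : realType) (A : nat) (F : 'I_A -> nat -> R).
Context (d : measure_display) (T : measurableType d) (P : probability T R).
Context (X : nat -> nat -> T -> config A) (chi : 'I_A -> R) (i j : 'I_A).
Hypothesis F0 : forall l k, 0 < F l k.
Hypothesis chi0 : forall l, 0 < chi l.
Hypothesis Pi : typeP F i.
Hypothesis urnX : forall N, is_polya_urn F P (start chi N) (X N).
Hypothesis ji : j != i.

(** [lam] is chosen after [N], and [K] may depend on [N]: strong monopoly asks only for some finite
    bound on the rivals. *)
Lemma prob_reach_near (eps : R) : 0 < eps -> typeP F j \/ ~ condM F j ->
  (limn_esup (fun N : nat =>
     (tail F i (start chi N i) / tail F j (start chi N j))%E) < 1%E)%E ->
  \forall N \near \oo, exists K : nat,
    (P [set w | exists k, (K <= X N k w j)%N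
                          \/ ~ urn_step (X N k w) (X N k.+1 w)] <= eps%:E)%E.
Proof.
move=> eps0 Pj /limn_esup_lt1[r r1 nr].
have bound (N K : nat) (lam dl q : R) : 0 <= lam -> dl < 1 -> 0 < q ->
    (forall l, (start chi N i <= l)%N -> 0 <= lam / F i l <= dl) ->
    (forall m, q <=
      expR (- (lam / (1 - dl) * \sum_(start chi N i <= l < m) (F i l)^-1))) ->
    eps^-1 <= q * \prod_(start chi N j <= l < K) (1 + lam / F j l) ->
    (P [set w | exists k, (K <= X N k w j)%N
                          \/ ~ urn_step (X N k w) (X N k.+1 w)] <= eps%:E)%E.
  move=> lam0 dl1 q0 lamF qle epsle.
  apply: (le_trans (@prob_reach_le R A F d T P _ (X N) i j lam q K F0 (urnX N)
    ji lam0 _ q0 _)).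
  - by move=> l /lamF/andP[_ /le_trans]; apply; exact: ltW.
  - by move=> m; apply: le_trans (qle m) _; exact: expR_le_prod1B.
  - rewrite lee_fin -[leRHS]invrK lef_pV2// posrE ?invr_gt0//.
    by apply: lt_le_trans epsle; rewrite invr_gt0.
have [Mi _] := Pi; case: Pj => [Pj|nMj].
  (* A quarter of the gap [1 - r] pays for the second-order losses in both products and for the tail
     of [j] beyond [K]. *)
  have [Mj _] := Pj; pose dl := (1 - r) / 4%:R.
  have dl0 : 0 < dl by rewrite /dl; lra.
  (* Chosen so that [c * dl = eps^-1]. *)
  pose c := (eps * dl)^-1; have c0 : 0 < c by rewrite invr_gt0 mulr_gt0.
  have [ki Hki] := typeP_ratio F0 c0 dl0 Pi.
  have [kj Hkj] := typeP_ratio F0 c0 dl0 Pj.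
  near=> N.
  have ai : (ki <= start chi N i)%N by near: N; exact: start_near.
  have aj : (kj <= start chi N j)%N by near: N; exact: start_near.
  have : (tail F i (start chi N i) / tail F j (start chi N j) <= r%:E)%E.
    by near: N.
  have [ti ti0 tiE] := condM_tailE F0 (start chi N i) Mi.
  have [tj tj0 tjE] := condM_tailE F0 (start chi N j) Mj.
  rewrite tiE tjE inver gt_eqF// -EFinM lee_fin ler_pdivrMr// => tij.
  have r0 : 0 < r by rewrite -(pmulr_lgt0 _ tj0); exact: lt_le_trans tij.
  have dl1 : dl < 1 by rewrite /dl; lra.
  (* A finite [K] captures all but a share [dl] of the tail of [j]. *)
  have [K HK] : exists K, (1 - dl) * tj < \sum_(start chi N j <= l < K) (F j l)^-1.
    by apply: lt_tail => //; rewrite tjE lte_fin; nra.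
  exists K; apply: (bound N K (c / tj) dl (expR (- (c / tj / (1 - dl) * ti)))).
  - by rewrite divr_ge0 ?ltW.
  - by [].
  - exact: expR_gt0.
  - move=> l al; apply/andP; split; first by rewrite !divr_ge0 ?ltW.
    apply: (Hki _ _ _ _ ai al tiE); nra.
  - move=> m; rewrite ler_expR lerN2 ler_wpM2l//.
      by rewrite !divr_ge0 ?ltW// subr_gt0.
    by rewrite -lee_fin -tiE; exact: partial_le_tail.
  have lamj l : (start chi N j <= l)%N -> 0 <= c / tj / F j l <= dl.
    move=> al; apply/andP; split; first by rewrite !divr_ge0 ?ltW.
    exact: (Hkj _ _ _ _ aj al tjE).
  apply: (@le_trans _ _ (expR (- (c / tj / (1 - dl) * ti)) *
      expR ((1 - dl) * (c / tj) * ((1 - dl) * tj)))); last first.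
    rewrite ler_wpM2l ?expR_ge0//; apply: le_trans (expR_le_prod1D _ lamj).
    rewrite ler_expR ler_wpM2l ?ltW//.
    by rewrite mulr_gt0 ?divr_gt0 ?subr_gt0.
  (* [r = 1 - 4 dl] gives [(1 - dl)^2 - r / (1 - dl) >= dl]. *)
  rewrite -expRD; apply: (@le_trans _ _ (c * dl)).
    by rewrite /c invfM -mulrA mulVf ?mulr1 ?gt_eqF.
  apply: (@le_trans _ _ (expR (c * dl))).
    by apply: le_trans (expR_ge1Dx _); rewrite lerDr.
  rewrite ler_expR.
  have -> : (1 - dl) * (c / tj) * ((1 - dl) * tj) = c * (1 - dl) ^+ 2.
    by field; exact: lt0r_neq0.
  have : c / tj / (1 - dl) * ti <= c * (1 - 3%:R * dl).
    rewrite -!mulrA ler_pM2l// mulrCA ler_pdivrMl ?subr_gt0//.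
    rewrite ler_pdivrMl//; apply: le_trans tij _; rewrite mulrC ler_pM2l//.
    by rewrite (_ : r = 1 - 4%:R * dl); [nra|rewrite /dl; field].
  suff : c * dl <= c * (1 - dl) ^+ 2 - c * (1 - 3%:R * dl) by lra.
  by rewrite -mulrBr ler_pM2l//; nra.
(* The rival violates (M): with [lam = 1 / ti] and [dl = 1 / 2] the factor of [i] never falls below
   [expR (- 2)]. *)
have half0 : 0 < 2^-1 :> R by rewrite invr_gt0.
have [ki Hki] := typeP_ratio F0 (@ltr01 R) half0 Pi.
near=> N.
have ai : (ki <= start chi N i)%N by near: N; exact: start_near.
have [ti ti0 tiE] := condM_tailE F0 (start chi N i) Mi.
have tjy : tail F j (start chi N j) = +oo%E.
  apply/eqP; rewrite -leye_eq leNgt; apply/negP => h; apply: nMj.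
  exact/(condM_tail F0 j (start chi N j)).
(* At this [K], [lam] times the sum exceeds [expR 2 / eps], which outweighs the factor of [i]. *)
have [K HK] : exists K, expR 2 / eps * ti < \sum_(start chi N j <= l < K) (F j l)^-1.
  by apply: lt_tail => //; rewrite tjy ltry.
exists K; apply: (bound N K (1 / ti) (2^-1) (expR (- 2))).
- by rewrite divr_ge0 ?ltW.
- lra.
- exact: expR_gt0.
- move=> l al; apply/andP; split; first by rewrite !divr_ge0 ?ltW.
  exact: (Hki _ _ _ _ ai al tiE).
- move=> m; rewrite ler_expR lerN2.
  apply: (@le_trans _ _ (1 / ti / (1 - 2^-1) * ti)).
    rewrite ler_wpM2l//; first by rewrite !divr_ge0 ?ltW//; lra.
    by rewrite -lee_fin -tiE; exact: partial_le_tail.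
  by rewrite le_eqVlt; apply/orP; left; apply/eqP; field; exact: lt0r_neq0.
rewrite expRN ler_pdivlMl ?expR_gt0//.
apply: le_trans (sum_le_prod1D _ _ _); last first.
  by move=> l; rewrite !divr_ge0 ?ltW.
rewrite mul1r ler_wpDl// ler_pdivlMl// mulrC; exact: ltW.
Unshelve. all: by end_near. Qed.

End reach.

(** * The strong monopoly event *)

Section monopoly.
Context (R : realType) (A : nat) (F : 'I_A -> nat -> R).
Context (d : measure_display) (T : measurableType d) (P : probability T R).
Context (x0 : config A) (X : nat -> T -> config A) (i : 'I_A).
Hypothesis urnX : is_polya_urn F P x0 X.

Let rivals (x : config A) := (\sum_(j < A | j != i) x j)%N.

(** A convergent sequence of integers is eventually constant; this writes the event by countable
    operations and yields its measurability. *)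
Lemma sMonE : sMon R i X =
  \bigcup_n \bigcap_m [set w | rivals (X (n + m)%N w) = rivals (X n w)].
Proof.
apply/seteqP; split => w.
  (* Two integers within 1/2 of the limit differ by less than 1. *)
  move=> /cvg_ex[/= l /cvgrPdist_lt /(_ 2^-1)]; rewrite invr_gt0 ltr0n => /(_ isT).
  move=> [n _ Hn]; exists n => // m _ /=.
  have ha : `|l - (rivals (X (n + m)%N w))%:R| < 2^-1 by exact: Hn (leq_addr _ _).
  have hb : `|l - (rivals (X n w))%:R| < 2^-1 by exact: Hn (leqnn _).
  move: ha hb; set a := rivals _; set b := rivals _ => ha hb; apply/eqP.
  have : `|a%:R - b%:R : R| < 1.
    have -> : a%:R - b%:R = (l - b%:R) - (l - a%:R) :> R by ring.
    by apply: le_lt_trans (ler_normB _ _) _; lra.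
  rewrite ltr_norml => /andP[h1 h2]; rewrite eqn_leq.
  by apply/andP; split; rewrite -ltnS -(ltr_nat R) -natr1; lra.
move=> [n _ Hn]; apply/cvg_ex; exists ((rivals (X n w))%:R).
apply: cvg_near_cst; exists n => // m /= nm.
by rewrite -(subnKC nm); congr (_%:R); exact: Hn.
Qed.

Lemma measurable_sMon : measurable (sMon R i X).
Proof.
rewrite sMonE; apply: bigcupT_measurable => n; apply: bigcapT_measurable => m.
exact: (measurable_urn2 urnX (n + m)%N n (fun x y => rivals x = rivals y)).
Qed.

(** Off these events the moves are increments and each rival [j] stays below [K j], so the total of
    the rivals is nondecreasing and bounded. *)
Lemma sub_sMon (K : 'I_A -> nat) :
  ~` (\big[setU/set0]_(j < A | j != i) [set w | exists k,
       (K j <= X k w j)%N \/ ~ urn_step (X k w) (X k.+1 w)]) `<=`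
  sMon R i X.
Proof.
move=> w; rewrite -(bigcup_pred (fun j => j != i)) => nE.
have nEj j k : j != i ->
    (X k w j < K j)%N /\ urn_step (X k w) (X k.+1 w).
  move=> ji; split.
    by rewrite ltnNge; apply/negP => Kj; apply: nE; exists j => //; exists k; left.
  by apply: contrapT => ns; apply: nE; exists j => //; exists k; right.
apply: nondecreasing_is_cvgn.
  apply/nondecreasing_seqP => n; rewrite ler_nat.
  apply: leq_sum => j ji; have [_ [l ->]] := nEj j n ji; exact: leq_incr.
exists ((\sum_(j < A | j != i) K j)%N%:R) => _ [n _ <-].
by rewrite ler_nat; apply: leq_sum => j ji; have [/ltnW] := nEj j n ji.
Qed.

End monopoly.

Theorem mainTheorem5 (R : realType) (A : nat) (F : 'I_A -> nat -> R)
  (d : measure_display) (T : measurableType d) (P : probability T R)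
  (X : nat -> nat -> T -> config A)
  (chi : 'I_A -> R) (i : 'I_A) :
  (2 <= A)%N ->
  (forall j k, 0 < F j k) ->
  (forall j, typeP F j \/ ~ condM F j) ->
  in_open_simplex chi ->
  typeP F i ->
  (forall j : 'I_A, j != i ->
     (limn_esup (fun N : nat =>
        (tail F i (start chi N i) / tail F j (start chi N j))%E) < 1%E)%E) ->
  (forall N : nat, is_polya_urn F P (start chi N) (X N)) ->
  (fun N : nat => P (sMon R i (X N))) @ \oo --> 1%E.
Proof.
move=> A2 F0 typ [chi0 _] Pi lims urnX.
have A0 : (0 < A)%N by exact: ltnW.
apply/fine_cvgP; split.
  by apply: nearW => N; apply: fin_num_measure; exact: measurable_sMon (urnX N).
apply/cvgrPdist_le => eps eps0.
(* An equal share of [eps] per agent, for the union bound over the rivals. *)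
pose e := eps / A%:R; have e0 : 0 < e by rewrite divr_gt0// ltr0n.
have : \forall N \near \oo, forall j, exists K : nat, j != i ->
    (P [set w | exists k, (K <= X N k w j)%N
          \/ ~ urn_step (X N k w) (X N k.+1 w)] <= e%:E)%E.
  apply: filter_forall => j; have [->|ji] := eqVneq j i.
    (* Agent [i] gets the default level 0, so that [choice] yields a total function [K]. *)
    by apply: nearW => N; exists 0%N.
  have := prob_reach_near F0 chi0 Pi urnX ji e0 (typ j) (lims j ji).
  by apply: filterS => N [K HK]; exists K.
apply: filterS => N /choice[K HK] /=.
have mS := measurable_sMon i (urnX N).
set S := sMon R i (X N); pose E j : set T := [set w | exists k,
  (K j <= X N k w j)%N \/ ~ urn_step (X N k w) (X N k.+1 w)].
have mE j : measurable (E j).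
  exact: (@measurable_hit_ever R A F d T P _ (X N) (urnX N) (fun x => (K j <= x j)%N)).
pose B := \big[setU/set0]_(j < A | j != i) E j.
have mB : measurable B by exact: bigsetU_measurable.
have PB : (P B <= eps%:E)%E.
  apply: (le_trans (measure_bigsetU_le P _ mE)).
  apply: (@le_trans _ _ (\sum_(j < A | j != i) e%:E)%E).
    by apply: lee_sum => j ji; exact: HK.
  apply: (@le_trans _ _ (\sum_(j < A) e%:E)%E).
    rewrite [leRHS](bigID (fun j => j != i))/= leeDl// sume_ge0// => j _.
    by rewrite lee_fin ltW.
  rewrite sumEFin sumr_const card_ord lee_fin -[leLHS]mulr_natr divfK//.
  by rewrite pnatr_eq0 -lt0n.
have PS1 : (P S <= 1)%E by exact: probability_le1.
have CS : (P (~` S) <= eps%:E)%E.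
  apply: le_trans PB; rewrite le_measure ?inE//; first exact: measurableC.
  by move=> w; apply: contra_notP => nBw; exact: (sub_sMon nBw).
have finS : P S \is a fin_num by exact: fin_num_measure.
rewrite probability_setC// in CS.
move: PS1 CS; rewrite -(fineK finS) -EFinB !lee_fin => PS1 CS.
by rewrite ger0_norm ?subr_ge0.
Qed.
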